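(* Let $\mathbb F\in\{\mathbb R,\mathbb C\}$ and let $P(\lambda)=\lambda(J_1+R_1)+(J_2+R_2)\in\mathbb F^{n,n}[\lambda]$, where $J_i^*=-J_i$ and $R_i^*=R_i\ge 0$ for $i=1,2$. Consider the following conditions: (a) $\ker R_1\cap\ker R_2=\{0\}$; (b) $\mathcal W(P(\lambda))\cap(0,+\infty)=\emptyset$; (c) $\mathcal W(P(\lambda))\ne\mathbb C$; (d) $P(\lambda)$ has no common isotropic vector; (e) $P(\lambda)$ is regular. If $\mathbb F=\mathbb C$, then (a)$\Rightarrow$(b)$\Rightarrow$(c)$\Rightarrow$(d)$\Rightarrow$(e). If $\mathbb F=\mathbb R$, then (a)$\Leftrightarrow$(b)$\Leftrightarrow$(c)$\Leftrightarrow$(d)$\Rightarrow$(e).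
   Context: $M^*$ denotes the conjugate transpose, $M\ge 0$ means Hermitian positive semidefinite. The numerical range of a matrix polynomial $L(\lambda)\in\mathbb F^{n,n}[\lambda]$ is $\mathcal W(L(\lambda))=\{\mu\in\mathbb C : x^*L(\mu)x=0\text{ for some }x\in\mathbb C^n\setminus\{0\}\}$ (complex vectors are used also when $\mathbb F=\mathbb R$). A matrix polynomial $\sum_{i=0}^d\lambda^iA_i$ has a common isotropic vector if there is a nonzero $x\in\mathbb C^n$ with $x^*A_ix=0$ for all $i=0,\dots,d$; for $P(\lambda)$ the coefficients are $A_1=J_1+R_1$ and $A_0=J_2+R_2$. A square pencil is regular if its determinant is not identically zero. *)

(* Defs.v *)
From HB Require Import structures.
From mathcomp Require Import all_boot all_order all_algebra.
From mathcomp Require Import spectral sesquilinear.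
From mathcomp Require Import complex.
From mathcomp Require Import boolp classical_sets set_interval reals.

Set Implicit Arguments.
Unset Strict Implicit.
Unset Printing Implicit Defensive.

Import Order.TTheory GRing.Theory Num.Theory.
Local Open Scope classical_set_scope.
Local Open Scope ring_scope.
Local Open Scope sesquilinear_scope.

(* A matrix polynomial is a matrix with polynomial entries, so that the
   dimension 0 is covered and the determinant is a polynomial. *)
Section MatrixPolynomial.
Variables (F : numFieldType) (n : nat).

Definition pencil (A1 A0 : 'M[F]_n) : 'M[{poly F}]_n :=
  'X *: map_mx polyC A1 + map_mx polyC A0.

Definition evalmxp (L : 'M[{poly F}]_n) (mu : F) : 'M[F]_n :=
  map_mx (horner_eval mu) L.

Definition coefmxp (L : 'M[{poly F}]_n) (i : nat) : 'M[F]_n :=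
  map_mx (coefp i) L.

Definition regular (L : 'M[{poly F}]_n) : Prop := \det L != 0.

(* Kernel for the action on column vectors; kermx is the row kernel. *)
Definition colker (M : 'M[F]_n) : set 'cV[F]_n := [set x | M *m x = 0].

(* theta is the conjugation of F: conjC for the complex numbers and the
   identity for the real numbers. *)
Definition psdmx (theta : F -> F) (M : 'M[F]_n) : Prop :=
  M ^t theta = M /\
  forall x : 'cV[F]_n, 0 <= (x ^t theta *m M *m x) 0 0.

End MatrixPolynomial.

Section NumericalRange.
Variables (C : numClosedFieldType) (n : nat).

Definition numrange (L : 'M[{poly C}]_n) : set C :=
  [set mu | exists2 x : 'cV[C]_n, x != 0 & x ^t* *m evalmxp L mu *m x = 0].

(* The coefficients beyond the degree of L vanish, so i may range over nat. *)
Definition common_isotropic (L : 'M[{poly C}]_n) : Prop :=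
  exists2 x : 'cV[C]_n, x != 0 & forall i, x ^t* *m coefmxp L i *m x = 0.

End NumericalRange.

Definition complexify (R : realType) n (L : 'M[{poly R}]_n) :
    'M[{poly R[i]}]_n := map_mx (map_poly (real_complex R)) L.

Definition posreals (R : realType) : set R[i] :=
  real_complex R @` `]0, +oo[%classic.
Arguments posreals R : clear implicits.

(* Main.v *)
Require Import Defs.
From HB Require Import structures.
From mathcomp Require Import all_boot all_order all_algebra.
From mathcomp Require Import spectral sesquilinear.
From mathcomp Require Import complex.
From mathcomp Require Import boolp classical_sets set_interval reals.
From mathcomp Require Import ring.

Set Implicit Arguments.
Unset Strict Implicit.
Unset Printing Implicit Defensive.

Import Order.TTheory GRing.Theory Num.Theory.
Local Open Scope classical_set_scope.
Local Open Scope ring_scope.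
Local Open Scope sesquilinear_scope.

(** The chain of implications rests on one observation.  Put
    A1 = J1 + R1 and A0 = J2 + R2.  If x^* (mu A1 + A0) x = 0 with mu > 0, then
    the real part of this equation is mu x^* R1 x + x^* R2 x = 0, a sum of
    two nonnegative terms; hence x^* R1 x = x^* R2 x = 0 and, by positive
    semidefiniteness, R1 x = R2 x = 0 (lemma [numrange_pos_ker]).  This is
    (a) -> (b).  The steps (b) -> (c) and (c) -> (d) are immediate: positive
    numbers exist, and a common isotropic vector puts every mu in the
    numerical range.

    For (d) -> (e), let det P = 0.  Over the integral domain of polynomials
    there is a nonzero polynomial vector x with P x = 0.  For mu > 0 the
    observation applies to x(mu), so R1 x and R2 x vanish at infinitely many
    points and are therefore zero.  At a nonreal mu with x(mu) != 0 the
    equation P(mu) x(mu) = 0 reduces to mu s1 + s2 = 0, where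
    si = x(mu)^* Ji x(mu) is purely imaginary; taking conjugates gives
    (mu - mu^* ) s1 = 0, so s1 = s2 = 0 and x(mu) is a common isotropic
    vector (lemma [singular_common_isotropic]).

    In the real case everything is transported to the complexified
    coefficients: semidefiniteness, skew-symmetry, condition (a) and
    regularity are all insensitive to this extension.  The cycle closes with
    (d) -> (a): a real vector x in both kernels satisfies
    x^T Ji x = 0 by skew-symmetry, hence is a common isotropic vector. *)

(** * Sesquilinear forms and positive semidefinite matrices *)

Section SesquilinearForm.
Variables (C : numClosedFieldType) (n : nat).
Implicit Types (A B : 'M[C]_n) (x y z : 'cV[C]_n).

Definition sesq A x y : C := (x ^t* *m A *m y) 0 0.

Lemma sesq_eq0P A x y : (x ^t* *m A *m y = 0) <-> (sesq A x y = 0).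
Proof.
rewrite /sesq; split=> [->|h0]; first by rewrite mxE.
by rewrite [LHS]mx11_scalar h0 -scalemx1 scale0r.
Qed.

Lemma sesqDm A B x y : sesq (A + B) x y = sesq A x y + sesq B x y.
Proof. by rewrite /sesq mulmxDr mulmxDl mxE. Qed.

Lemma sesqNm A x y : sesq (- A) x y = - sesq A x y.
Proof. by rewrite /sesq mulmxN mulNmx mxE. Qed.

Lemma sesqZm a A x y : sesq (a *: A) x y = a * sesq A x y.
Proof. by rewrite /sesq -scalemxAr -scalemxAl mxE. Qed.

Lemma sesqDr A x y z : sesq A x (y + z) = sesq A x y + sesq A x z.
Proof. by rewrite /sesq mulmxDr mxE. Qed.

Lemma sesqZr a A x y : sesq A x (a *: y) = a * sesq A x y.
Proof. by rewrite /sesq -scalemxAr mxE. Qed.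

Lemma sesq_conj A x y : (sesq A x y)^* = sesq (A ^t*) y x.
Proof.
have -> : (sesq A x y)^* = ((x ^t* *m A *m y) ^t*) 0 0 by rewrite /sesq !mxE.
by rewrite /sesq !trmx_mul !map_mxM trmxCK mulmxA.
Qed.

Lemma sesqDl A x y z : sesq A (x + y) z = sesq A x z + sesq A y z.
Proof. by rewrite /sesq linearD map_mxD !mulmxDl mxE. Qed.

Lemma sesqZl a A x y : sesq A (a *: x) y = a^* * sesq A x y.
Proof. by rewrite /sesq linearZ map_mxZ -!scalemxAl mxE. Qed.

Lemma sesq0r A x y : A *m y = 0 -> sesq A x y = 0.
Proof. by rewrite /sesq -mulmxA => ->; rewrite mulmx0 mxE. Qed.

Lemma sesq_skew_conj A x : A ^t* = - A -> (sesq A x x)^* = - sesq A x x.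
Proof. by move=> Ask; rewrite sesq_conj Ask sesqNm. Qed.

Lemma psd_sesq_ge0 A x : psdmx Num.conj A -> 0 <= sesq A x x.
Proof. by case=> _; apply. Qed.

Lemma sesq1_ge0 x : 0 <= sesq 1%:M x x.
Proof.
rewrite /sesq mulmx1 mxE sumr_ge0 // => i _.
by rewrite !mxE mulrC mul_conjC_ge0.
Qed.

Lemma sesq1_eq0 x : sesq 1%:M x x = 0 -> x = 0.
Proof.
rewrite /sesq mulmx1 mxE => /psumr_eq0P x0.
apply/matrixP=> i j; rewrite ord1 [RHS]mxE; apply/eqP.
rewrite -mul_conjC_eq0 mulrC; apply/eqP.
have := x0 _ i isT; rewrite !mxE; apply=> k _.
by rewrite !mxE mulrC mul_conjC_ge0.
Qed.

(** Perturbing an isotropic vector x in the direction y = A x changes the form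
    to first order by - 2 s |y|^2, which would make it negative for small
    s > 0 unless y = 0. *)
Lemma psd_isotropic_ker A x : psdmx Num.conj A -> sesq A x x = 0 -> A *m x = 0.
Proof.
move=> psdA Axx; have [hA _] := psdA.
set y := A *m x; set a := sesq 1%:M y y; set b := sesq A y y.
have a0 : 0 <= a := sesq1_ge0 y.
have b0 : 0 <= b := psd_sesq_ge0 y psdA.
have Ayx : sesq A y x = a by rewrite /a /sesq mulmx1 -mulmxA.
have Axy : sesq A x y = a.
  by rewrite -[LHS]conjCK sesq_conj hA Ayx; apply/conj_Creal/ger0_real.
have b1 : 0 < b + 1 by rewrite ltr_wpDl.
(* this s satisfies s * b <= a, so that s ^+ 2 * b - s * a *+ 2 <= - s * a *)
set s := a / (b + 1).
have s0 : 0 <= s by rewrite divr_ge0 // ltW.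
have sC : s^* = s by apply/conj_Creal/ger0_real.
have sb : s * b <= a.
  by rewrite /s mulrAC ler_pdivrMr // ler_wpM2l // lerDl.
have := psd_sesq_ge0 (x + (- s) *: y) psdA.
rewrite sesqDl !sesqDr !sesqZl !sesqZr rmorphN /= sC Axx Axy Ayx -/b.
rewrite add0r !mulNr mulrN opprK addrA -opprD => ge0.
have sa_le0 : s * a <= 0.
  rewrite -oppr_ge0; apply: le_trans ge0 _.
  by rewrite opprD -addrA gerDl addrC subr_le0 ler_wpM2l.
apply: sesq1_eq0; rewrite -/a.
have : s * a = 0 by apply/le_anti; rewrite sa_le0 mulr_ge0.
move/eqP; rewrite /s mulrAC mulf_eq0 invr_eq0 (gt_eqF b1) orbF mulf_eq0 orbb.
by move/eqP.
Qed.

End SesquilinearForm.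

(** * Pencils *)

Lemma evalmxp_pencil (F : numFieldType) n (A1 A0 : 'M[F]_n) mu :
  evalmxp (pencil A1 A0) mu = mu *: A1 + A0.
Proof. by apply/matrixP=> i j; rewrite !mxE /horner_eval !hornerE. Qed.

Lemma coefmxp_pencil (F : numFieldType) n (A1 A0 : 'M[F]_n) k :
  coefmxp (pencil A1 A0) k =
  if k == 0%N then A0 else if k == 1%N then A1 else 0.
Proof.
apply/matrixP=> i j; rewrite !mxE /= coefD coefXM !coefC.
by case: k => [|[|k]] /=; rewrite ?mxE ?add0r ?addr0.
Qed.

Section PencilOverComplex.
Variables (C : numClosedFieldType) (n : nat).

Lemma numrange_pencilP (A1 A0 : 'M[C]_n) mu :
  numrange (pencil A1 A0) mu <->
  exists2 x : 'cV[C]_n, x != 0 & mu * sesq A1 x x + sesq A0 x x = 0.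
Proof.
split=> -[x x0 h]; exists x => //; move: h; rewrite ?evalmxp_pencil.
  by move/sesq_eq0P; rewrite sesqDm sesqZm.
by move=> h; apply/sesq_eq0P; rewrite sesqDm sesqZm.
Qed.

Lemma common_isotropic_pencilP (A1 A0 : 'M[C]_n) :
  common_isotropic (pencil A1 A0) <->
  exists2 x : 'cV[C]_n, x != 0 & sesq A1 x x = 0 /\ sesq A0 x x = 0.
Proof.
split=> -[x x0 h]; exists x => //.
  by split; apply/sesq_eq0P; [have := h 1%N | have := h 0%N];
    rewrite coefmxp_pencil.
move=> k; rewrite coefmxp_pencil; case: h => h1 h0.
case: eqP => _; first exact/sesq_eq0P.
by case: eqP => _; [exact/sesq_eq0P | rewrite mulmx0 mul0mx].
Qed.

Lemma common_isotropic_numrange (A1 A0 : 'M[C]_n) :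
  common_isotropic (pencil A1 A0) -> numrange (pencil A1 A0) = setT.
Proof.
move=> /common_isotropic_pencilP[x x0 [h1 h0]]; apply/seteqP; split=> // mu _.
by apply/numrange_pencilP; exists x; rewrite // h1 h0 mulr0 addr0.
Qed.

End PencilOverComplex.

(** * Polynomial vectors *)

(** Applied below to the points 1 + k and 'i + k, so as to pass from positive,
    or from nonreal, points to identities between polynomials. *)
Lemma poly_injective_roots0 (F : idomainType) (f : nat -> F) (p : {poly F}) :
  injective f -> (forall k, p.[f k] = 0) -> p = 0.
Proof.
move=> finj fp; apply/eqP/negP => /negP p0.
have := @max_poly_roots _ p (mkseq f (size p)) p0.
rewrite mkseq_uniq // size_mkseq ltnn => h; apply: notF; apply: h => //.
by apply/allP=> _ /mapP[k _ ->]; apply/eqP.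
Qed.

Lemma natrDl_inj (F : numDomainType) (a : F) :
  injective (fun k : nat => a + k%:R).
Proof. by move=> k l /addrI /eqP; rewrite eqr_nat => /eqP. Qed.

(** * Pencils whose coefficients have positive semidefinite Hermitian part *)

Section PositivePencil.
Variables (C : numClosedFieldType) (n : nat) (J1 R1 J2 R2 : 'M[C]_n).
Hypotheses (J1skew : J1 ^t* = - J1) (R1psd : psdmx Num.conj R1).
Hypotheses (J2skew : J2 ^t* = - J2) (R2psd : psdmx Num.conj R2).

(** The source of all the implications: for mu > 0 the skew-Hermitian parts
    contribute only to the imaginary part of the form, and the real part is a
    sum of two nonnegative terms. *)
Lemma numrange_pos_ker mu (x : 'cV[C]_n) : 0 < mu ->
  mu * sesq (J1 + R1) x x + sesq (J2 + R2) x x = 0 ->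
  R1 *m x = 0 /\ R2 *m x = 0.
Proof.
move=> mu0; have r1 := psd_sesq_ge0 x R1psd; have r2 := psd_sesq_ge0 x R2psd.
have muC : mu^* = mu by apply/conj_Creal/gtr0_real.
rewrite !sesqDm => h.
(* adding the conjugate equation cancels the contribution of J1 and J2 *)
have := congr1 Num.conj h; rewrite !(rmorphD, rmorphM, rmorph0) /= muC.
rewrite (sesq_skew_conj _ J1skew) (sesq_skew_conj _ J2skew).
rewrite (conj_Creal (ger0_real r1)) (conj_Creal (ger0_real r2)) => hC.
have : mu * sesq R1 x x + sesq R2 x x = 0.
  have /eqP : (mu * sesq R1 x x + sesq R2 x x) *+ 2 = 0.
    by rewrite -[RHS]addr0 -{1}h -hC; ring.
  by rewrite mulrn_eq0 => /eqP.
move/eqP; rewrite paddr_eq0 ?mulr_ge0 ?(ltW mu0) // mulf_eq0 (gt_eqF mu0) /=.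
by case/andP=> /eqP ? /eqP ?; split; exact: psd_isotropic_ker.
Qed.

Lemma kerI0_numrange_pos mu : colker R1 `&` colker R2 = [set 0] ->
  0 < mu -> ~ numrange (pencil (J1 + R1) (J2 + R2)) mu.
Proof.
move=> a mu0 /numrange_pencilP[x /eqP x0 /(numrange_pos_ker mu0) k].
by apply: x0; have : (colker R1 `&` colker R2) x by []; rewrite a.
Qed.

(** A polynomial null vector x of P is killed by R1 and R2 at positive points,
    hence everywhere, so that only J1 and J2 are left; at a nonreal point two
    imaginary numbers s1, s2 with mu s1 + s2 = 0 must both vanish. *)
Lemma singular_common_isotropic :
  ~ regular (pencil (J1 + R1) (J2 + R2)) ->
  common_isotropic (pencil (J1 + R1) (J2 + R2)).
Proof.
set P := pencil _ _ => /negP; rewrite negbK -det_tr => /det0P[v v0 vP].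
pose x mu : 'cV[C]_n := map_mx (horner_eval mu) v^T.
have Px mu : (mu *: (J1 + R1) + (J2 + R2)) *m x mu = 0.
  rewrite -evalmxp_pencil -map_mxM -/P -[P]trmxK -trmx_mul vP trmx0.
  exact: map_mx0.
have form mu : mu * sesq (J1 + R1) (x mu) (x mu)
               + sesq (J2 + R2) (x mu) (x mu) = 0.
  by rewrite -sesqZm -sesqDm sesq0r.
have ker_pos mu : 0 < mu -> R1 *m x mu = 0 /\ R2 *m x mu = 0.
  by move=> mu0; exact: numrange_pos_ker mu0 (form mu).
have ker_all (M : 'M[C]_n) :
    (forall mu, 0 < mu -> M *m x mu = 0) -> forall mu, M *m x mu = 0.
  move=> kM.
  have evM mu : map_mx (horner_eval mu) (map_mx polyC M *m v^T) = M *m x mu.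
    rewrite map_mxM; congr (_ *m _).
    by apply/matrixP=> i j; rewrite !mxE /= /horner_eval hornerC.
  suff Mv0 : map_mx polyC M *m v^T = 0.
    by move=> mu; rewrite -evM Mv0; exact: map_mx0.
  apply/matrixP=> i j; rewrite [RHS]mxE.
  apply: (poly_injective_roots0 (natrDl_inj (a := 1))) => k.
  have := evM (1 + k%:R); rewrite kM ?ltr_wpDr //.
  by move/matrixP/(_ i j); rewrite mxE [RHS]mxE.
have k1 := ker_all R1 (fun mu h => (ker_pos mu h).1).
have k2 := ker_all R2 (fun mu h => (ker_pos mu h).2).
(* all the candidates 'i + k are nonreal, and x cannot vanish at all of them *)
have [k xk] : exists k : nat, x ('i + k%:R) != 0.
  apply: contrapT => /forallNP xi0; move/eqP: v0; apply.
  apply/matrixP=> i j; rewrite [RHS]mxE.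
  apply: (poly_injective_roots0 (natrDl_inj (a := 'i))) => k.
  have /negP := xi0 k; rewrite negbK => /eqP/matrixP/(_ j i).
  by rewrite !mxE.
set mu := 'i + k%:R in xk.
have nonreal : mu - mu^* != 0.
  rewrite /mu rmorphD /= conjCi rmorph_nat opprD opprK addrACA subrr addr0.
  by rewrite -mulr2n mulrn_eq0 /= neq0Ci.
have := form mu; rewrite !sesqDm (sesq0r _ (k1 mu)) (sesq0r _ (k2 mu)) !addr0.
set s1 := sesq J1 _ _; set s2 := sesq J2 _ _ => h.
have hC : mu^* * s1 + s2 = 0.
  have := congr1 Num.conj h; rewrite !(rmorphD, rmorphM, rmorph0) /=.
  rewrite (sesq_skew_conj _ J1skew) (sesq_skew_conj _ J2skew) mulrN -opprD => /eqP.
  by rewrite oppr_eq0 => /eqP.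
have s10 : s1 = 0.
  apply/eqP; rewrite -(mulrI_eq0 _ (mulfI nonreal)) mulrBl; apply/eqP.
  by rewrite -(subrr 0) -{1}h -hC opprD addrACA subrr addr0.
have s20 : s2 = 0 by move: h; rewrite s10 mulr0 add0r.
apply/common_isotropic_pencilP; exists (x mu) => //.
by rewrite !sesqDm (sesq0r _ (k1 mu)) (sesq0r _ (k2 mu)) !addr0.
Qed.

End PositivePencil.

(** * Complexification of real matrices *)

Section Complexification.
Variable (R : realType).

Local Notation cx := (map_mx (real_complex R)).

Lemma posrealsE : posreals R = [set mu | 0 < mu].
Proof.
apply/seteqP; split=> [_ [r /= + <-]|[r s]] /=.
  by rewrite in_itv /= andbT ltcR.
rewrite ltcE /= => /andP[/eqP -> r0]; exists r => //=.
by rewrite in_itv /= andbT.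
Qed.

Lemma complexify_pencil n (A1 A0 : 'M[R]_n) :
  complexify (pencil A1 A0) = pencil (cx A1) (cx A0).
Proof.
apply/matrixP=> i j; rewrite !mxE rmorphD rmorphM /=.
by rewrite map_polyX !map_polyC.
Qed.

Lemma regular_complexify n (L : 'M[{poly R}]_n) :
  regular (complexify L) <-> regular L.
Proof. by rewrite /regular /complexify det_map_mx map_poly_eq0. Qed.

Lemma cx_trmxC m n (A : 'M[R]_(m, n)) : (cx A) ^t* = cx A^T.
Proof.
apply/matrixP=> i j; rewrite !mxE.
by apply/conj_Creal; rewrite complex_real.
Qed.

Lemma cx_skew n (J : 'M[R]_n) : J^T = - J -> (cx J) ^t* = - cx J.
Proof. by rewrite cx_trmxC => ->; rewrite map_mxN. Qed.

Lemma cx_split n (x : 'cV[R[i]]_n) :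
  exists u v : 'cV[R]_n, x = cx u + 'i *: cx v.
Proof.
exists (map_mx (@complex.Re R) x), (map_mx (@complex.Im R) x).
by apply/matrixP=> i j; rewrite !mxE [LHS]complexE.
Qed.

Lemma cx_split_eq0 n (u v : 'cV[R]_n) :
  cx u + 'i *: cx v = 0 -> u = 0 /\ v = 0.
Proof.
move=> h; split; apply/matrixP=> i j; move/matrixP/(_ i j): h; rewrite !mxE;
  by rewrite -complexiE -(complexE (u i j +i* v i j)%C) => -[].
Qed.

Lemma sesq_cx n (A : 'M[R]_n) (u v : 'cV[R]_n) :
  sesq (cx A) (cx u) (cx v) = real_complex R ((u^T *m A *m v) 0 0).
Proof. by rewrite /sesq cx_trmxC -!map_mxM mxE. Qed.

(** For symmetric A the cross terms of the form at u + i v cancel, leaving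
    u^T A u + v^T A v. *)
Lemma cx_psd n (A : 'M[R]_n) : psdmx idfun A -> psdmx Num.conj (cx A).
Proof.
case; rewrite map_mx_id // => symA psdA; split; first by rewrite cx_trmxC symA.
move=> x; rewrite -/(sesq _ _ _); have [u [v ->]] := cx_split x.
have vu : (v^T *m A *m u) 0 0 = (u^T *m A *m v) 0 0.
  have -> : v^T *m A *m u = (u^T *m A *m v)^T.
    by rewrite !trmx_mul trmxK symA mulmxA.
  by rewrite mxE.
rewrite sesqDl !sesqDr !sesqZl !sesqZr !sesq_cx vu conjCi.
rewrite !mulNr addrA addrK mulrA -expr2 sqrCi mulN1r opprK -rmorphD lecR.
by have := addr_ge0 (psdA u) (psdA v); rewrite !map_mx_id.
Qed.

Lemma cx_kerI0 n (A B : 'M[R]_n) : colker A `&` colker B = [set 0] ->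
  colker (cx A) `&` colker (cx B) = [set 0].
Proof.
move=> a; apply/seteqP; split=> [x|_ ->]; last by split; rewrite /colker /= mulmx0.
have [u [v ->]] := cx_split x; rewrite /colker /= => -[].
rewrite !mulmxDr -!scalemxAr -!map_mxM.
move=> /cx_split_eq0[Au Av] /cx_split_eq0[Bu Bv].
have : (colker A `&` colker B) u by [].
have : (colker A `&` colker B) v by [].
by rewrite a => -> ->; rewrite map_mx0 scaler0 addr0.
Qed.

(** A skew-symmetric matrix has a vanishing real quadratic form, since the
    number u^T J u equals its own transpose. *)
Lemma skew_quad_eq0 n (J : 'M[R]_n) (u : 'cV[R]_n) : J^T = - J ->
  u^T *m J *m u = 0.
Proof.
move=> Jskew.
have h : (u^T *m J *m u)^T = - (u^T *m J *m u).
  by rewrite !trmx_mul trmxK Jskew mulNmx mulmxN mulmxA.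
apply/matrixP=> i j; rewrite !ord1 [RHS]mxE; apply/eqP.
by move/matrixP/(_ 0 0): h; rewrite mxE [RHS]mxE -eqNr => /esym/eqP.
Qed.

Lemma real_ker_common_isotropic n (J1 R1 J2 R2 : 'M[R]_n) :
  J1^T = - J1 -> J2^T = - J2 ->
  ~ common_isotropic (complexify (pencil (J1 + R1) (J2 + R2))) ->
  colker R1 `&` colker R2 = [set 0].
Proof.
rewrite complexify_pencil => J1skew J2skew d.
apply/seteqP; split=> [u [k1 k2]|_ ->]; last by split; rewrite /colker /= mulmx0.
apply/eqP/negP => /negP u0; apply/d/common_isotropic_pencilP.
have form (J S : 'M[R]_n) : J^T = - J -> S *m u = 0 ->
    sesq (cx (J + S)) (cx u) (cx u) = 0.
  move=> Jskew Su; rewrite sesq_cx mulmxDr mulmxDl skew_quad_eq0 //.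
  by rewrite -mulmxA Su mulmx0 addr0 mxE rmorph0.
exists (cx u); first by rewrite map_mx_eq0.
by split; exact: form.
Qed.

End Complexification.

Theorem theorem5p4 (R : realType) (n : nat) :
  (forall J1 R1 J2 R2 : 'M[R[i]]_n,
     J1 ^t* = - J1 -> psdmx Num.conj R1 ->
     J2 ^t* = - J2 -> psdmx Num.conj R2 ->
     let P := pencil (J1 + R1) (J2 + R2) in
     let a := colker R1 `&` colker R2 = [set 0] in
     let b := numrange P `&` posreals R = set0 in
     let c := numrange P <> setT in
     let d := ~ common_isotropic P in
     let e := regular P in
     [/\ a -> b, b -> c, c -> d & d -> e])
  /\
  (forall J1 R1 J2 R2 : 'M[R]_n,
     J1^T = - J1 -> psdmx idfun R1 ->
     J2^T = - J2 -> psdmx idfun R2 ->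
     let P := pencil (J1 + R1) (J2 + R2) in
     let a := colker R1 `&` colker R2 = [set 0] in
     let b := numrange (complexify P) `&` posreals R = set0 in
     let c := numrange (complexify P) <> setT in
     let d := ~ common_isotropic (complexify P) in
     let e := regular P in
     [/\ a <-> b, b <-> c, c <-> d & d -> e]).
Proof.
have complex_case (J1 R1 J2 R2 : 'M[R[i]]_n) :
     J1 ^t* = - J1 -> psdmx Num.conj R1 ->
     J2 ^t* = - J2 -> psdmx Num.conj R2 ->
     let P := pencil (J1 + R1) (J2 + R2) in
     [/\ colker R1 `&` colker R2 = [set 0] ->
           numrange P `&` posreals R = set0,
         numrange P `&` posreals R = set0 -> numrange P <> setT,
         numrange P <> setT -> ~ common_isotropic P
       & ~ common_isotropic P -> regular P].
  move=> J1skew R1psd J2skew R2psd P; rewrite posrealsE; split.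
  - move=> a; apply/seteqP; split=> // mu [W mu0].
    exact: kerI0_numrange_pos W.
  - move=> b PT; have : (numrange P `&` [set mu | 0 < mu]) 1.
      by rewrite PT; split=> //=; exact: ltr01.
    by rewrite b.
  - by move=> c /common_isotropic_numrange.
  - move=> d; apply: contrapT => singP; apply: d.
    exact: singular_common_isotropic singP.
split=> // J1 R1 J2 R2 J1skew R1psd J2skew R2psd P a b c d e.
have := complex_case _ _ _ _ (cx_skew J1skew) (cx_psd R1psd)
  (cx_skew J2skew) (cx_psd R2psd).
rewrite -!map_mxD -complexify_pencil -/P => -[ab bc cd de].
have {}ab : a -> b by move=> /cx_kerI0; exact: ab.
have da : d -> a by exact: real_ker_common_isotropic.
split; last by move=> /de /regular_complexify.
- by split=> // /bc /cd /da.
- by split=> // /cd /da /ab.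
- by split=> // /da /ab /bc.
Qed.
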